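(* For each integer $t\geq 1$ there is a constant $C_t$ such that for every integer $n\ge t$, any $t$-reachability network on $n$ elements using only star transpositions has length at least $(2-1/t)n-C_t$.
   Context: Write $[n]=\{1,\dots,n\}$, let $S_n$ be the symmetric group on $[n]$, and for distinct $a,b\in[n]$ let $(a,b)\in S_n$ denote the transposition swapping $a$ and $b$. A star transposition is a transposition of the form $(1,x)$ with $x\in\{2,\dots,n\}$. For $1\le t\le n$, a finite sequence of transpositions $T_1,\dots,T_\ell\in S_n$ (repetitions allowed), with $T_i=(a_i,b_i)$, is a $t$-reachability network on $n$ elements if for every choice of $t$ distinct ordered points $x_1,\dots,x_t\in[n]$ there is a (possibly empty) subsequence $T_{i_1},\dots,T_{i_{\ell'}}$ with $i_1<\dots<i_{\ell'}$ whose composition $(a_{i_1},b_{i_1})\cdots(a_{i_{\ell'}},b_{i_{\ell'}})$ maps $j\mapsto x_j$ for every $1\le j\le t$. Products are applied in the order of the sequence, left to right: $T_{i_1}$ is applied first (equivalently, counters placed at positions $1,\dots,t$ are moved by carrying out the chosen switches in order, and counter $j$ must end at position $x_j$). The length of the network is $\ell$, the number of transpositions in the sequence. *)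

(* Defs.v *)
From mathcomp Require Import all_boot all_order all_algebra all_fingroup.

Set Implicit Arguments.
Unset Strict Implicit.
Unset Printing Implicit Defensive.

(* The point set [n] = {1, ..., n} is encoded as 'I_n, the point k being the
   ordinal of value k - 1; in particular the point 1 is the ordinal of value 0. *)

Definition transposition (n : nat) (s : 'S_n) : Prop :=
  exists a b : 'I_n, a != b /\ s = tperm a b.

Definition star_transposition (n : nat) (s : 'S_n) : Prop :=
  exists a x : 'I_n, [/\ nat_of_ord a = 0%N, x != a & s = tperm a x].

(* In 'S_n one has (s * s') i = s' (s i), so the ordered product of a sequence
   applies its head first. A subsequence is selected by positions ([mask]), so
   repeated entries of T count as distinct switches. *)
Definition reachability_network (t n : nat) (le_tn : (t <= n)%N)
    (T : seq 'S_n) : Prop :=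
  (forall s, s \in T -> transposition s) /\
  (forall x : 'I_t -> 'I_n, injective x ->
     exists2 U : seq 'S_n, subseq U T &
       forall j : 'I_t, (\prod_(u <- U) u)%g (widen_ord le_tn j) = x j).

(* Main.v *)
(** Call a point outside {1, ..., t} single if exactly one switch moves it. Take
    two singles x, x' with the switch of x first. Just after the switch of x the
    centre is empty, and it must be occupied just before the switch of x'. Assume
    that every switch in between moves a point outside {1, ..., t} and is the
    first or the last switch of that point, and let Y be the set of points having
    their last but not their first switch there. A point outside Y is still empty
    when it meets the centre in between, so Y together with the centre cannot
    become full. Hence x, x' and Y cannot all be targets, and |Y| >= t - 1.
    So between any two singles there are t - 1 last-but-not-first switches, or
    one switch that is neither first nor last at its point or that moves an
    initial point. Each of the n - t points outside {1, ..., t} has a first and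
    a last switch, and weighting the four kinds of switches gives the bound. *)
Require Import Defs.
From mathcomp Require Import all_boot all_order all_algebra all_fingroup.
From mathcomp Require Import zify ring lra.

Set Implicit Arguments.
Unset Strict Implicit.
Unset Printing Implicit Defensive.

Import Order.TTheory GRing.Theory Num.Theory.

(** * Counting separated marks, and covering a list of targets *)

Lemma sum_marks_le (s : pred nat) (c : nat -> nat) (u l : nat) :
  (forall i j, (i < j < l)%N -> s i -> s j ->
     (u <= \sum_(i.+1 <= k < j) c k)%N) ->
  (u * \sum_(0 <= k < l) s k <= u + \sum_(0 <= k < l) c k)%N.
Proof.
move=> gap.
(* The induction has to remember the last mark [i]: the weight beyond it is still unspent and can
   pay for the gap up to the next mark. *)
have [->|[i [lt_il _ le_i]]] : \sum_(0 <= k < l) s k = 0%N \/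
    exists i, [/\ (i < l)%N, s i &
      (u * \sum_(0 <= k < l) s k <= u + \sum_(0 <= k < i) c k)%N].
- elim: l gap => [|l IH] gap; first by left; rewrite big_nil.
  rewrite big_nat_recr //=.
  have {}IH := IH (fun i j Hij => gap i j (ltac:(lia))).
  case Esl: (s l); last first.
    rewrite addn0; case: IH => [->|[i [lt_il si le_i]]]; first by left.
    by right; exists i; split=> //; lia.
  right; exists l; split=> //.
  case: IH => [->|[i [lt_il si le_i]]]; first by lia.
  have := gap i l (ltac:(lia)) si Esl.
  have -> : \sum_(0 <= k < l) c k =
      (\sum_(0 <= k < i) c k + (c i + \sum_(i.+1 <= k < l) c k))%N.
    by rewrite -big_ltn // -big_cat_nat //; lia.
  by lia.
- by rewrite muln0.
- apply: leq_trans le_i _; rewrite leq_add2l.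
  by rewrite [leqRHS](@big_cat_nat _ _ _ i) //= ?leq_addr // ltnW.
Qed.

(** Reachability prescribes an end point for each of [t] counters. A list of at most [t] targets
    becomes such a prescription by padding [undup s] with the other points. *)
Lemma ex_injective_cover (T : finType) (s : seq T) (t : nat) :
  (size s <= t)%N -> (t <= #|T|)%N ->
  exists2 x : 'I_t -> T, injective x & forall y, y \in s -> exists j, x j = y.
Proof.
move=> le_st le_tT.
case: t => [|t] in le_st le_tT *.
  case: s le_st => // _; exists (fun j : 'I_0 => False_rect _ (notF (ltn_ord j))) => //.
  by case.
have /card_gt0P [x0 _] : (0 < #|T|)%N by lia.
pose r := undup s ++ [seq y <- enum T | y \notin s].
have r_uniq : uniq r.
  rewrite cat_uniq undup_uniq filter_uniq ?enum_uniq // andbT /=.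
  apply/hasPn => y; rewrite mem_filter mem_undup /=; by case/andP.
have r_size : size r = #|T|.
  rewrite -(card_uniqP r_uniq); apply: eq_card => y.
  by rewrite mem_cat mem_undup mem_filter mem_enum andbT orbN.
exists (fun j : 'I_t.+1 => nth x0 r j) => [j1 j2 /eqP|y ys].
  have lt_r (j : 'I_t.+1) : (j < size r)%N.
    by rewrite r_size (leq_trans (ltn_ord j)).
  by rewrite nth_uniq // => /eqP/val_inj.
have yu : y \in undup s by rewrite mem_undup.
have lt_yt : (index y (undup s) < t.+1)%N.
  by apply: leq_trans le_st; apply: leq_trans (size_undup s); rewrite index_mem.
by exists (Ordinal lt_yt); rewrite /= nth_cat index_mem yu nth_index.
Qed.

(** * Occupied points under switches that may be skipped *)

(** Counters are indistinguishable here: [st k] is the set of occupied points before switch [k],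
    which is skipped or swaps the centre [h] with [w k]. *)
Definition switching_run (T : finType) (h : T) (w : nat -> T) (l : nat)
    (st : nat -> pred T) : Prop :=
  forall k, (k < l)%N ->
    st k.+1 =1 st k \/ forall y, st k.+1 y = st k (tperm h (w k) y).

Section SwitchingRun.

Variables (T : finType) (h : T) (w : nat -> T) (l : nat) (st : nat -> pred T).
Hypothesis run : switching_run h w l st.

Lemma run_const (z : T) (a b : nat) :
  z != h -> (a <= b <= l)%N -> (forall k, (a <= k < b)%N -> w k != z) ->
  st b z = st a z.
Proof.
move=> zh; elim: b => [|b IH] ab wz; first by congr (st _ z); lia.
have [<-//|ne_ab] := eqVneq a b.+1.
rewrite -IH; [|lia|by move=> k Hk; apply: wz; lia].
have [|E|E] := @run b; [lia|exact: E|].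
by rewrite E tpermD // 1?eq_sym // eq_sym wz //; lia.
Qed.

(** Going back in time, [Y] and [h] stay full: a switch at a point of [Y] permutes full points, and
    one at an empty point must have been skipped, as it would leave [h] empty. *)
Lemma run_full (Y : pred T) (a b : nat) :
  (a <= b <= l)%N ->
  (forall k, (a <= k < b)%N -> Y (w k) \/ st k (w k) = false) ->
  st b h -> (forall y, Y y -> st b y) -> st a h.
Proof.
elim: b => [|b IH] ab Yw sh sY; first by have -> : a = 0%N by lia.
have [->//|ne_ab] := eqVneq a b.+1.
have full : st b h /\ forall y, Y y -> st b y.
  have [|E|E] := @run b; first by lia.
    by split=> [|y /sY]; rewrite -E.
  have [|Yb|Nb] := Yw b; first by lia.
    have sb : st b h by have := sY _ Yb; rewrite E tpermR.
    have sw : st b (w b) by have := sh; rewrite E tpermL.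
    by split=> // y /sY; rewrite E; case: tpermP => [->|->|].
  by move: sh; rewrite E tpermL Nb.
by case: full; apply: IH => [|k Hk]; [|apply: Yw]; lia.
Qed.

End SwitchingRun.

(** * First and last switches of the points outside [I] *)

Section Marks.

Variables (T : finType) (h : T) (w : nat -> T) (l : nat) (I : pred T).

Definition switched_before (k : nat) : bool :=
  [exists i : 'I_l, (i < k) && (w i == w k)].
Definition switched_after (k : nat) : bool :=
  [exists i : 'I_l, (k < i) && (w i == w k)].

Definition first_switch (k : nat) : bool := ~~ I (w k) && ~~ switched_before k.
Definition last_switch (k : nat) : bool := ~~ I (w k) && ~~ switched_after k.
Definition single_switch (k : nat) : bool := first_switch k && last_switch k.
Definition closing_switch (k : nat) : bool := ~~ first_switch k && last_switch k.
(** Every switch of a point of [I] falls here, since it fails both tests. *)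
Definition other_switch (k : nat) : bool := ~~ first_switch k && ~~ last_switch k.

Lemma before_neq (i k : nat) :
  (k < l)%N -> ~~ switched_before k -> (i < k)%N -> w i != w k.
Proof.
move=> kl /existsPn Nk ik; have il := ltn_trans ik kl.
by have := Nk (Ordinal il); rewrite /= ik.
Qed.

Lemma after_neq (i k : nat) :
  ~~ switched_after k -> (k < i < l)%N -> w i != w k.
Proof.
by move=> /existsPn Nk /andP[ki il]; have := Nk (Ordinal il); rewrite /= ki.
Qed.

(** The least index at which a point outside [I] is switched is a first switch, so [w] maps the
    first switches onto these points. *)
Lemma card_first_switch :
  (forall z, ~~ I z -> exists2 k, (k < l)%N & w k = z) ->
  (#|[pred z | ~~ I z]| <= \sum_(0 <= k < l) first_switch k)%N.
Proof.
move=> occ; rewrite big_mkord -sum1_card.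
rewrite -big_mkcond /= sum1_card sum1_card.
apply: leq_trans (leq_image_card (fun k : 'I_l => w k) _).
apply: subset_leq_card; apply/subsetP => z; rewrite inE => Iz.
have [k kl wk] := occ z Iz.
pose P := [pred k : 'I_l | w k == z].
have Pk : P (Ordinal kl) by apply/eqP.
case: (arg_minnP (fun k : 'I_l => k : nat) Pk) => m /eqP wm min_m.
apply/imageP; exists m => //; rewrite unfold_in /first_switch wm Iz /=.
apply/existsPn => i; rewrite negb_and -leqNgt; case: leqP => //= im.
by apply/eqP => wi; have := min_m i; rewrite /= wi wm eqxx leqNgt im => /(_ isT).
Qed.

Lemma card_last_switch :
  (forall z, ~~ I z -> exists2 k, (k < l)%N & w k = z) ->
  (#|[pred z | ~~ I z]| <= \sum_(0 <= k < l) last_switch k)%N.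
Proof.
move=> occ; rewrite big_mkord -sum1_card.
rewrite -big_mkcond /= sum1_card sum1_card.
apply: leq_trans (leq_image_card (fun k : 'I_l => w k) _).
apply: subset_leq_card; apply/subsetP => z; rewrite inE => Iz.
have [k kl wk] := occ z Iz.
pose P := [pred k : 'I_l | w k == z].
have Pk : P (Ordinal kl) by apply/eqP.
case: (arg_maxnP (fun k : 'I_l => k : nat) Pk) => m /eqP wm max_m.
apply/imageP; exists m => //; rewrite unfold_in /last_switch wm Iz /=.
apply/existsPn => i; rewrite negb_and -leqNgt; case: leqP => //= im.
by apply/eqP => wi; have := max_m i; rewrite /= wi wm eqxx leqNgt im => /(_ isT).
Qed.

Definition reaches (s : seq T) : Prop :=
  exists st, [/\ switching_run h w l st, st 0 =1 I & forall y, y \in s -> st l y].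

Hypothesis Ih : I h.
Hypothesis wh : forall k, (k < l)%N -> w k != h.

Lemma run_const_initial (st : nat -> pred T) (k : nat) :
  switching_run h w l st -> st 0 =1 I -> (k < l)%N -> first_switch k ->
  st k (w k) = false.
Proof.
move=> run st0 kl /andP[Ik Bk].
rewrite (run_const run (wh kl) (_ : 0 <= k <= l)%N) ?st0 ?(negbTE Ik) ?(ltnW kl) //.
by move=> i /andP[_ ik]; apply: before_neq.
Qed.

Lemma run_const_final (st : nat -> pred T) (k b : nat) :
  switching_run h w l st -> (k < b <= l)%N -> last_switch k ->
  st l (w k) = st b (w k).
Proof.
move=> run kbl /andP[Ik Ak].
have kl : (k < l)%N by lia.
apply: (run_const run (wh kl)); first by lia.
by move=> i Hi; apply: after_neq => //; lia.
Qed.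

Lemma closing_switches_between (i j u : nat) :
  (forall s, (size s <= u.+1)%N -> reaches s) ->
  (i < j < l)%N -> single_switch i -> single_switch j ->
  (u <= \sum_(i.+1 <= k < j) (closing_switch k + u * other_switch k))%N.
Proof.
move=> reach ijl si sj; rewrite leqNgt; apply/negP => small.
have [[fi li] [fj lj]] : (first_switch i /\ last_switch i) /\
  (first_switch j /\ last_switch j) by split; apply/andP.
pose Y := [seq w k | k <- index_iota i.+1 j & closing_switch k].
have sizeY : (size Y < u)%N.
  rewrite size_map size_filter -sum1_count big_mkcond /=.
  apply: leq_ltn_trans small; apply: leq_sum => k _.
  by case: closing_switch.
(* One other switch alone weighs [u], against [small]. *)
have no_other k : (i < k < j)%N -> ~~ other_switch k.
  move=> Hk; apply: contraTN small => ok; rewrite -leqNgt.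
  rewrite (@big_cat_nat _ _ _ k) /=; [|lia|lia].
  by rewrite [X in (_ + X)%N]big_ltn ?ok; lia.
(* Two singles and fewer than [u] points of [Y] are at most [u.+1] targets. *)
have [|st [run st0 stl]] := reach [:: w i, w j & Y]; first by rewrite /=; lia.
have il : (i < l)%N by lia.
have jl : (j < l)%N by lia.
have /negP := run_const_initial run st0 il fi; apply.
have stiS : st i.+1 (w i).
  by rewrite -(run_const_final run _ li) ?stl ?mem_head //; lia.
have stjS : st j.+1 (w j).
  by rewrite -(run_const_final run _ lj) ?stl ?inE ?eqxx ?orbT //; lia.
(* Since [w j] is empty before switch [j] and occupied after it, this switch is applied and takes a
   counter from the centre. *)
have stj : st j h.
  have [E|E] := run j jl.
    by move: stjS; rewrite E (run_const_initial run st0 jl fj).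
  by move: stjS; rewrite E tpermR.
have fullY y : y \in Y -> st j y.
  move=> yY; have := stl y; rewrite !inE yY !orbT => /(_ isT).
  case/mapP: yY => k; rewrite mem_filter mem_index_iota => /andP[/andP[_ lk] ikj] ->.
  by rewrite (@run_const_final _ k j) //; lia.
have stih : st i.+1 h.
  apply: (run_full run (Y := mem Y)) stj fullY; first by lia.
  move=> k ikj; have [fk|Nfk] := boolP (first_switch k).
    by right; apply: run_const_initial => //; lia.
  left; apply/mapP; exists k => //; rewrite mem_filter mem_index_iota ikj andbT.
  by have := no_other k ikj; rewrite /other_switch /closing_switch Nfk /= negbK.
(* Whether switch [i] is skipped or applied, [w i] would be occupied before its first switch. *)
have [E|E] := run i il; first by rewrite -E.
by move: stih; rewrite E tpermL.
Qed.

Lemma star_switches_lower_bound (u : nat) :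
  (forall s, (size s <= u.+1)%N -> reaches s) ->
  ((2 * u + 1) * #|[pred z | ~~ I z]| <= u.+1 * l + u)%N.
Proof.
move=> reach.
have occ z : ~~ I z -> exists2 k, (k < l)%N & w k = z.
  move=> Iz; have zh : z != h by apply: contraNneq Iz => ->.
  have [|st [run st0 stl]] := reach [:: z]; first by [].
  have [/existsP [k /eqP wk]|/existsPn Nk] := boolP [exists k : 'I_l, w k == z].
    by exists k.
  case/negP: (Iz); rewrite -st0 -(run_const run zh (_ : 0 <= l <= l)%N) ?leqnn //.
    by rewrite stl ?mem_head.
  by move=> k /andP[_ kl]; apply: (Nk (Ordinal kl)).
have marks := sum_marks_le (fun i j Hij => closing_switches_between reach Hij).
have F := card_first_switch occ; have L := card_last_switch occ.
(* The weights give equality for single, first-only and closing switches, and slack 1 for the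
   others. After summation [marks] absorbs [u * single_switch] into the closing and other terms, up
   to one extra [u]. *)
have : (\sum_(0 <= k < l) (u.+1 * first_switch k + u * last_switch k
          + (closing_switch k + u * other_switch k))
        <= \sum_(0 <= k < l) (u.+1 + u * single_switch k))%N.
  apply: leq_sum => k _; rewrite /closing_switch /other_switch /single_switch.
  by case: first_switch; case: last_switch => /=; lia.
rewrite !big_split /= -!big_distrr /= sum_nat_const_nat in marks *.
nia.
Qed.

End Marks.

(** * From subsequences of a network to runs *)

Lemma subseq_switching_run (n : nat) (h : 'I_n) (U T : seq 'S_n) (I : pred 'I_n) :
  subseq U T -> (forall s, s \in T -> s = tperm h (s h)) ->
  exists st, [/\ switching_run h (fun k => nth 1%g T k h) (size T) st,
    st 0 =1 I & forall i, st (size T) ((\prod_(s <- U) s)%g i) = I i].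
Proof.
case/subseqP=> m sz_m -> star.
(* A point is occupied when its preimage under the switches chosen among the first [k] lies in [I],
   hence the inverse. *)
exists (fun k y => I ((\prod_(s <- mask (take k m) (take k T)) s)^-1%g y)).
split=> [k kT|y|i].
- rewrite (take_nth false) ?sz_m // (take_nth 1%g) // mask_rcons ?size_take ?sz_m //.
  case: (nth false m k) => /=; [right|left] => y; last by rewrite cats0.
  rewrite big_cat big_seq1 /= invMg permM.
  by rewrite {1}[nth 1%g T k]star ?mem_nth // tpermV.
- by rewrite !take0 big_nil invg1 perm1.
- by rewrite -sz_m take_size sz_m take_size permK.
Qed.

(** * Arithmetic of the constant, and the theorem *)

Local Open Scope ring_scope.

(** With [t = u + 1], multiplying by [t] leaves a loss of [(2t - 1)t + (t - 1) = 2t^2 - 1], which is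
    below [2t^2]; this is where the constant [2t] comes from. *)
Lemma scaled_bound_rat (u n l : nat) :
  (u < n)%N -> ((2 * u + 1) * (n - u.+1) <= u.+1 * l + u)%N ->
  (2 - 1 / u.+1%:R) * n%:R - 2 * u.+1%:R <= l%:R :> rat.
Proof.
move=> lt_un; rewrite -(leq_add2l ((2 * u + 1) * u.+1)) -mulnDr subnKC //.
rewrite -(ler_nat rat) -[u.+1]addn1 !(natrD, natrM).
move: (u%:R : rat) (n%:R : rat) (l%:R : rat) (ler0n rat u) => x y z x_ge0 bound.
have x1_gt0 : 0 < x + 1 by lra.
rewrite -(ler_pM2l x1_gt0).
have -> : (x + 1) * ((2 - 1 / (x + 1)) * y - 2 * (x + 1))
    = (2 * x + 1) * y - 2 * (x + 1) ^+ 2.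
  by field; rewrite lt0r_neq0 //; lra.
nra.
Qed.

Theorem proposition7 (t : nat) (t_ge1 : (1 <= t)%N) :
  exists C : rat,
    forall (n : nat) (le_tn : (t <= n)%N) (T : seq 'S_n),
      reachability_network le_tn T ->
      (forall s, s \in T -> star_transposition s) ->
      (2 - 1 / t%:R) * n%:R - C <= (size T)%:R.
Proof.
exists (2 * t%:R) => n le_tn T [_ reach] star.
case: t => [//|u] in t_ge1 le_tn reach *.
have n_gt0 : (0 < n)%N by lia.
(* [h] is the point 1 and [I] the set of starting places of the counters; [w] reads off the other
   end of a star transposition as its image of [h]. *)
pose h := Ordinal n_gt0; pose w k := nth 1%g T k h; pose I := [pred z : 'I_n | z < u.+1]%N.
have starE s : s \in T -> s = tperm h (s h) /\ s h != h.
  case/star=> a [x [a0 xa ->]].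
  have -> : a = h by apply: val_inj.
  by rewrite tpermL; split=> //; rewrite -(_ : a = h) //; apply: val_inj.
have wh k : (k < size T)%N -> w k != h by move=> kT; case: (starE _ (mem_nth 1%g kT)).
have reachI s : (size s <= u.+1)%N -> reaches h w (size T) I s.
  move=> sz_s; have [|x x_inj xs] := ex_injective_cover sz_s; first by rewrite card_ord.
  have [U UT Ux] := reach x x_inj.
  have [|st [run st0 stl]] := subseq_switching_run (h := h) I UT.
    by move=> p /starE[].
  exists st; split=> // y /xs[j <-]; rewrite -Ux stl /=; exact: ltn_ord.
have := star_switches_lower_bound (I := I) (h := h) isT wh reachI.
have -> : #|[pred z | ~~ I z]| = (n - u.+1)%N.
  have cardI : #|I| = u.+1.
    have widen_inj : injective (widen_ord le_tn) by move=> a b [/val_inj].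
    rewrite -[RHS]card_ord -(card_codom widen_inj).
    apply: eq_card => z; apply/idP/codomP => [zu|[j ->]]; last by rewrite inE /= ltn_ord.
    by exists (Ordinal zu); apply: val_inj.
  apply: (@addnI u.+1); rewrite subnKC // -[X in (X + _)%N]cardI -[RHS]card_ord.
  exact: cardC.
exact: scaled_bound_rat.
Qed.
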